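(* Let $q=p^e$ be an odd prime power, $K=\mathbb F_q(t)$, and let $d\ge 3$ be an integer with $p\nmid d$. Let $f_c(x)=cx^d+t\in K[x]$, where $c\in\mathbb F_q[t]\setminus\{0\}$. Define $a_n=f_c^{\circ n}(0)$ and set $h:=ct^{d-1}$. Assume that $h\notin\mathbb F_q[t^p]$. Then there exists an integer $N_0\ge 4$, depending on $c$, $q$ and $d$, such that for every $n\ge N_0$ the element $a_n$ possesses a primitive simple divisor. More precisely, for every $n\ge N_0$ there exists an irreducible polynomial $P_n\in\mathbb F_q[t]$ satisfying $$v_{P_n}(a_n)=1\qquad\text{and}\qquad P_n\nmid c\,t\,a_1a_2\cdots a_{n-1}.$$
   Context: $f^{\circ n}$ denotes the $n$-fold iterate. For an irreducible polynomial $P\in\mathbb F_q[t]$, $v_P$ is the corresponding normalized discrete valuation on $K$. *)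

(* Defs.v *)
From mathcomp Require Import all_boot all_order all_algebra.
From mathcomp Require Import fraction constructive_ereal.

Set Implicit Arguments.
Unset Strict Implicit.
Unset Printing Implicit Defensive.

Import GRing.Theory.
Local Open Scope ring_scope.

Notation "x %:F" := (tofrac x) : ring_scope.

(* The variable 'X of {poly F} plays the role of t.  The coefficients of f_c
   lie in F[t], so its iterates at 0 are computed there; see [orbit0_tofrac]. *)
Definition fc (F : fieldType) (c : {poly F}) (d : nat) : {poly {poly F}} := c *: 'X^d + 'X%:P.

Definition orbit0 (F : fieldType) (c : {poly F}) (d : nat) (n : nat) : {poly F} :=
  iter n (horner (fc c d)) 0.

Lemma orbit0_tofrac (F : fieldType) (c : {poly F}) (d : nat) n :
  (orbit0 c d n)%:F
  = iter n (horner (map_poly (@tofrac {poly F}) (fc c d))) 0.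
Proof.
elim: n => [|n IHn] /=; first exact: tofrac0.
by rewrite -IHn horner_map.
Qed.

(* For irreducible P and g != 0, the exponent of P in g; the bound loses nothing
   because k < size (P ^+ k) as soon as size P > 1. *)
Definition multiplicity (F : fieldType) (P g : {poly F}) : nat :=
  \max_(k < size g | P ^+ k %| g) k.

(* The fraction x is written as the quotient of the numerator and denominator of
   its representative; [adic_val_div] shows that the choice is immaterial. *)
Definition adic_val (F : fieldType) (P : {poly F}) (x : {fraction {poly F}}) : \bar int :=
  if x == 0 then +oo%E
  else ((multiplicity P \n_(repr x))%:Z - (multiplicity P \d_(repr x))%:Z)%:E.

Lemma multiplicityP (F : fieldType) (P g : {poly F}) k :
  irreducible_poly P -> g != 0 -> (P ^+ k %| g) = (k <= multiplicity P g)%N.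
Proof.
move=> irrP g0; have [sP _] := irrP.
have szP j : (j < size (P ^+ j))%N.
  have P0 : P != 0 by rewrite -size_poly_gt0 (ltn_trans _ sP).
  have := size_exp P j; rewrite -subn1 => h.
  have Pj : (0 < size (P ^+ j))%N by rewrite size_poly_gt0 expf_neq0.
  rewrite -(prednK Pj) ltnS -subn1 h leq_pmull // -subn1 subn_gt0 //.
apply/idP/idP => [Pk|].
  have kg : (k < size g)%N := leq_trans (szP k) (dvdp_leq g0 Pk).
  exact: (@leq_bigmax_cond _ _ (fun i : 'I_(size g) => i : nat) (Ordinal kg)).
have sg : (0 < size g)%N by rewrite size_poly_gt0.
have : P ^+ multiplicity P g %| g.
  rewrite /multiplicity.
  elim/big_ind: _ => [|x y Hx Hy|i //]; first by rewrite expr0 dvd1p.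
  by rewrite /maxn; case: ifP.
by move=> Pm km; apply: dvdp_trans Pm; apply: dvdp_exp2l.
Qed.

Lemma multiplicityM (F : fieldType) (P g h : {poly F}) :
  irreducible_poly P -> g != 0 -> h != 0 ->
  multiplicity P (g * h) = (multiplicity P g + multiplicity P h)%N.
Proof.
move=> irrP g0 h0; have [sP _] := irrP.
have P0 : P != 0 by rewrite -size_poly_gt0 (ltn_trans _ sP).
have dec (u : {poly F}) : u != 0 ->
    exists2 v, u = P ^+ multiplicity P u * v & ~~ (P %| v).
  move=> u0; have : P ^+ multiplicity P u %| u by rewrite multiplicityP.
  move=> /dvdpP[v uE]; exists v; first by rewrite mulrC.
  apply/negP => /dvdpP[w vE].
  have : P ^+ (multiplicity P u).+1 %| u.
    by apply/dvdpP; exists w; rewrite {1}uE vE exprS mulrA.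
  by rewrite multiplicityP // ltnn.
have [g' gE Ng] := dec g g0; have [h' hE Nh] := dec h h0.
have gh0 : g * h != 0 by rewrite mulf_neq0.
have ghE : g * h = P ^+ (multiplicity P g + multiplicity P h) * (g' * h').
  by rewrite {1}gE {1}hE exprD mulrACA.
apply/eqP; rewrite eqn_leq -multiplicityP // [X in _ %| X]ghE dvdp_mulr ?dvdpp // andbT.
rewrite leqNgt -multiplicityP // ghE exprSr dvdp_mul2l ?expf_neq0 //.
have cop (v : {poly F}) : ~~ (P %| v) -> coprimep P v.
  by rewrite irreducible_poly_coprime.
by rewrite Gauss_dvdpr // cop.
Qed.

Lemma adic_val_div (F : fieldType) (P g h : {poly F}) :
  irreducible_poly P -> g != 0 -> h != 0 ->
  adic_val P (g%:F / h%:F)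
  = ((multiplicity P g)%:Z - (multiplicity P h)%:Z)%:E.
Proof.
move=> irrP g0 h0; rewrite /adic_val mulf_eq0 invr_eq0 !tofrac_eq0 (negPf g0) (negPf h0) /=.
set x := _ / _; set n := \n_(repr x); set m := \d_(repr x).
have m0 : m != 0 := denom_ratioP _.
have xE : x = n%:F / m%:F.
  apply: (mulIf (x := m%:F)); first by rewrite tofrac_eq0.
  rewrite divfK ?tofrac_eq0 // -[x in LHS]reprK.
  rewrite /GRing.mul /= !piE; apply/eqmodP; rewrite /= FracField.equivfE.
  by rewrite !numden_Ratio ?mulr1 ?oner_neq0 // mulrC.
have x0 : x != 0 by rewrite mulf_neq0 ?invr_eq0 ?tofrac_eq0.
have n0 : n != 0.
  by apply: contraNneq x0 => n0; rewrite xE n0 tofrac0 mul0r.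
have : g * m == n * h.
  rewrite -tofrac_eq !tofracM -eqr_div ?tofrac_eq0 //.
  by rewrite -/x {1}xE.
move=> /eqP /(congr1 (multiplicity P)); rewrite !multiplicityM // => E.
congr (_%:E); apply/eqP; rewrite subr_eq addrAC eq_sym subr_eq.
by rewrite -!PoszD E.
Qed.

(* Main.v *)
(** Write a_n = t b_n with b_1 = 1 and b_(n+1) = h b_n^d + 1, where h = c t^(d-1).
    The b_n satisfy b_(m+k) = b_k modulo b_m^2 for k > 0, so if P divides b_m with
    m minimal then v_P(b_n) <= v_P(b_m) for every n > 0; moreover b_n is prime to
    h and to b_(n-1).  The derivative factors as b_n' = b_(n-1)^(d-1) w with
    w = h' b_(n-1) + d h b_(n-1)', and w <> 0 because h divides neither h' nor
    h' b_(n-1).  A primitive P with v_P(b_n) = e satisfies P^(e-1) | w, so if b_n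
    had no simple primitive divisor it would divide w^2 b_1 ... b_(n-2).  Since
    d >= 3, that product has smaller degree than b_n as soon as n >= 3. *)

Require Import Defs.
From mathcomp Require Import all_boot all_order all_algebra.
From mathcomp Require Import fraction constructive_ereal.
From mathcomp Require Import qfpoly finfield zify.

Set Implicit Arguments.
Unset Strict Implicit.
Unset Printing Implicit Defensive.

Import GRing.Theory.
Local Open Scope ring_scope.

(** * Degrees as natural numbers *)

Definition deg (F : fieldType) (f : {poly F}) : nat := (size f).-1.

Lemma deg1 (F : fieldType) : deg (1 : {poly F}) = 0%N.
Proof. by rewrite /deg size_poly1. Qed.

Lemma degM (F : fieldType) (f g : {poly F}) :
  f != 0 -> g != 0 -> deg (f * g) = (deg f + deg g)%N.
Proof.
move=> f0 g0; rewrite /deg size_mul //; move: f0 g0; rewrite -!size_poly_gt0.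
by case: (size f) => // m; case: (size g) => // k _ _; rewrite addSn addnS.
Qed.

Lemma degX (F : fieldType) (f : {poly F}) n : deg (f ^+ n) = (deg f * n)%N.
Proof. exact: size_exp. Qed.

Lemma degD (F : fieldType) (f g : {poly F}) :
  (deg (f + g) <= maxn (deg f) (deg g))%N.
Proof.
rewrite /deg -!subn1 -subn_maxl; exact/leq_sub2r/size_polyD.
Qed.

Lemma degD1 (F : fieldType) (f : {poly F}) : (0 < deg f)%N -> deg (f + 1) = deg f.
Proof.
move=> f0; rewrite /deg size_polyDl // size_poly1.
by move: f0; rewrite /deg; case: (size f) => [|[]].
Qed.

Lemma deg_gt0 (F : fieldType) (f : {poly F}) : (0 < deg f)%N = (1 < size f)%N.
Proof. by rewrite /deg; case: (size f) => [|[]]. Qed.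

Lemma deg_dvdp (F : fieldType) (f g : {poly F}) :
  g != 0 -> f %| g -> (deg f <= deg g)%N.
Proof. by move=> g0 fg; rewrite /deg -!subn1; apply/leq_sub2r/dvdp_leq. Qed.

Lemma deg_deriv_lt (F : fieldType) (f : {poly F}) :
  f^`() != 0 -> (deg f^`() < deg f)%N.
Proof.
move=> f'0; have f0 : f != 0 by apply: contraNneq f'0 => ->; rewrite deriv0.
have := lt_size_deriv f0; move: f'0; rewrite -size_poly_gt0 /deg.
by case: (size f^`()) => // m _; case: (size f).
Qed.

(** * Irreducible divisors and multiplicities *)

Lemma exists_irreducible_dvdp (F : finFieldType) (f : {poly F}) :
  (1 < size f)%N -> exists2 P : {poly F}, irreducible_poly P & P %| f.
Proof.
have [n] := ubnP (size f); elim: n f => // n IHn f szf f1.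
(* Over a finite field [irreducibleb] searches the finitely many polynomials of smaller size, so its
   failure supplies a smaller nonconstant divisor. *)
have [irrf|] := boolP (irreducibleb f); first by exists f => //; apply/irreducibleP.
rewrite /irreducibleb f1 /= => /forallPn[g]; rewrite negb_imply -Pdiv.Idomain.dvdpE.
move=> /andP[gf g1].
have f0 : f != 0 by rewrite -size_poly_gt0 (ltn_trans _ f1).
have g0 : (g : {poly F}) != 0 by apply: contraNneq f0 => g0; rewrite -dvd0p -g0.
have gsz : (1 < size g)%N by rewrite ltnNge.
have szg : (size g < n)%N.
  apply: leq_ltn_trans (size_npoly g) _.
  by rewrite -ltnS prednK // (ltn_trans _ f1).
have [P irrP Pg] := IHn g szg gsz.
by exists P => //; apply: dvdp_trans gf.
Qed.

Lemma multiplicity_gt0 (F : fieldType) (P g : {poly F}) :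
  irreducible_poly P -> g != 0 -> (0 < multiplicity P g)%N = (P %| g).
Proof. by move=> irrP g0; rewrite -multiplicityP // expr1. Qed.

(** Induction on [deg f]: an irreducible factor of [f] either misses [g], and is the witness, or
    cancels from both, which shifts both multiplicities equally. *)
Lemma Ndvdp_multiplicity (F : finFieldType) (f g : {poly F}) :
    f != 0 -> g != 0 -> ~~ (f %| g) ->
  exists2 P, irreducible_poly P & (multiplicity P g < multiplicity P f)%N.
Proof.
have [n] := ubnP (deg f); elim: n f g => // n IHn f g szf f0 g0 Nfg.
have f1 : (1 < size f)%N.
  rewrite ltnNge; apply: contraNN Nfg => f1.
  have /eqP : size f == 1%N by rewrite eqn_leq f1 size_poly_gt0.
  by move=> /eqP; rewrite size_poly_eq1 => /eqp_dvdl->; rewrite dvd1p.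
have [P irrP Pf] := exists_irreducible_dvdp f1.
have [Pg|NPg] := boolP (P %| g); last first.
  exists P => //; apply: leq_ltn_trans (_ : 0 < _)%N.
    by rewrite leqNgt multiplicity_gt0.
  by rewrite multiplicity_gt0.
have P0 := irredp_neq0 irrP; have [P1 _] := irrP.
case/dvdpP: Pf f0 szf Nfg {f1} => f' ->; case/dvdpP: Pg g0 => g' ->.
rewrite !mulf_eq0 !negb_or => /andP[g0 _] /andP[f0 _] szf.
rewrite dvdp_mul2r // => Nfg; have [||//|//|Q irrQ ltQ] := IHn f' g' => //.
  by move: szf; rewrite -deg_gt0 in P1; rewrite degM //; lia.
by exists Q => //; rewrite !multiplicityM // ltn_add2r.
Qed.

(** The coefficients i f_i of f' vanish, so only exponents divisible by p survive in f. The
    contrapositive turns the hypothesis on h into h' <> 0. *)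
Lemma deriv0_comp_polyXp (F : fieldType) (p : nat) (f : {poly F}) :
  p \in [pchar F] -> f^`() = 0 -> exists g : {poly F}, f = g \Po 'X^p.
Proof.
move=> pF f'0; have p0 := prime_gt0 (pcharf_prime pF).
exists (\poly_(i < size f) f`_(i * p)); apply/polyP => -[|i].
  rewrite coef_comp_poly_Xn // dvdn0 div0n coef_poly mul0n.
  by case: ltnP => // sf; rewrite nth_default.
rewrite coef_comp_poly_Xn //; case: ifPn => [pi|Npi].
  rewrite coef_poly divnK //; case: ltnP => // sf; rewrite nth_default //.
  by apply: leq_trans sf _; apply: leq_div.
have /eqP := congr1 (fun u : {poly F} => u`_i) f'0.
rewrite coef0 coef_deriv -mulr_natr mulf_eq0 -(dvdn_pcharf pF) (negPf Npi) orbF.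
by move/eqP.
Qed.

(** * The normalized orbit b_n: degrees and divisibility *)

Section Orbit.

Variables (F : fieldType) (h : {poly F}) (d : nat).
Hypotheses (h'0 : h^`() != 0) (hd : (3 <= d)%N).

(* This is orbit0 with the factor 'X removed; see [orbit0E]. *)
Definition unit_orbit (n : nat) : {poly F} := iter n (fun x => h * x ^+ d + 1) 0.

Arguments unit_orbit : simpl never.
Local Notation b := unit_orbit.
Local Notation D n := (deg (b n)).

Lemma unit_orbitS n : b n.+1 = h * b n ^+ d + 1.
Proof. by []. Qed.

Lemma unit_orbit1 : b 1 = 1.
Proof. by rewrite unit_orbitS expr0n (gtn_eqF (ltn_trans _ hd)) // mulr0 add0r. Qed.

Lemma deg_base_gt0 : (0 < deg h)%N.
Proof. exact: leq_ltn_trans (deg_deriv_lt h'0). Qed.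

Lemma base_neq0 : h != 0.
Proof. by apply: contraNneq h'0 => ->; rewrite deriv0. Qed.

(** For n > 0, b_n is 1 modulo h, and h is not constant. *)
Lemma unit_orbit_neq0 n : (0 < n)%N -> b n != 0.
Proof.
case: n => // n _; elim: n => [|n IHn]; first by rewrite unit_orbit1 oner_neq0.
apply: contraTneq deg_base_gt0 => bn0; rewrite -leqNgt.
have : h %| b n.+2 - 1 by rewrite unit_orbitS addrK dvdp_mulr.
rewrite bn0 sub0r dvdpNr => /deg_dvdp; rewrite deg1; apply; exact: oner_neq0.
Qed.

Lemma deg_unit_orbitS n : (0 < n)%N -> D n.+1 = (deg h + D n * d)%N.
Proof.
move=> n0; have hb : deg (h * b n ^+ d) = (deg h + D n * d)%N.
  by rewrite degM ?expf_neq0 ?unit_orbit_neq0 ?base_neq0 // degX.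
by rewrite unit_orbitS degD1 hb // addn_gt0 deg_base_gt0.
Qed.

Lemma prod_unit_orbit_neq0 n : \prod_(1 <= m < n.+1) b m != 0.
Proof.
rewrite prodf_seq_neq0; apply/allP => m; rewrite mem_index_iota => /andP[m0 _].
exact: unit_orbit_neq0.
Qed.

Lemma deg_prod_unit_orbit n :
  deg (\prod_(1 <= m < n.+1) b m) = (\sum_(1 <= m < n.+1) D m)%N.
Proof.
elim: n => [|n IHn]; first by rewrite !big_geq ?deg1.
rewrite !(big_nat_recr n.+1) // -IHn.
by apply: degM; [apply: prod_unit_orbit_neq0 | apply: unit_orbit_neq0].
Qed.

(** The slack [deg h] is kept for the final degree count, where w^2 brings in 2 deg h and the
    recursion for b_n only one. *)
Lemma deg_unit_orbit_sum n : (0 < n)%N ->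
  (\sum_(1 <= m < n.+1) D m + deg h <= D n.+1)%N.
Proof.
elim: n => // -[|n] IHn _.
  by rewrite big_nat1 (deg_unit_orbitS (n := 1)) // unit_orbit1 deg1; lia.
rewrite big_nat_recr //= [in leqRHS]deg_unit_orbitS //.
by have := IHn isT; nia.
Qed.

Lemma coprime_unit_orbit n P : irreducible_poly P -> P %| b n.+1 ->
  ~~ (P %| h) /\ ~~ (P %| b n).
Proof.
move=> [P1 _] Pb; have NP1 : ~~ (P %| 1) by rewrite dvdp1 neq_ltn P1 orbT.
split; apply: contraNN NP1 => Px; move: Pb; rewrite unit_orbitS dvdp_addr //.
  exact: dvdp_mulr.
by apply/dvdp_mull/(dvdp_trans Px)/dvdp_exp; first exact: ltnW (ltnW hd).
Qed.

(** The map x |-> h x^d + 1 preserves congruences, and at k = 0 the difference is h b_m^d with d >=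
    2. The index is [k.+1] because b_m and b_0 = 0 in general agree only modulo b_m. *)
Lemma unit_orbit_modn m k : b m ^+ 2 %| b (m + k.+1) - b k.+1.
Proof.
have X2 (x : {poly F}) : x ^+ 2 %| x ^+ d by apply/dvdp_exp2l/ltnW.
elim: k => [|k IHk]; rewrite addnS !unit_orbitS opprD addrACA subrr addr0.
  rewrite addn0 expr0n (gtn_eqF (ltn_trans _ hd)) // mulr0 subr0.
  exact/dvdp_mull.
by rewrite -mulrBr subrXX; apply/dvdp_mull/dvdp_mulr.
Qed.

(** Descent from n to n - m: for e = v_P(b_m) > 0 we have e + 1 <= 2e, so P^(e+1) divides b_m^2, and
    it divides b_n only if it divides b_(n-m). *)
Lemma multiplicity_unit_orbit_le P m n : irreducible_poly P ->
    (0 < m)%N -> (0 < n)%N -> P %| b m ->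
  (forall i, (0 < i < m)%N -> ~~ (P %| b i)) ->
  (multiplicity P (b n) <= multiplicity P (b m))%N.
Proof.
move=> irrP m0 n0 Pm minm; elim/ltn_ind: n n0 => n IHn n0.
have [nm|mn|->//] := ltngtP n m.
  apply: leq_trans (leq0n _); rewrite leqNgt multiplicity_gt0 ?unit_orbit_neq0 //.
  by rewrite minm ?n0.
set e := multiplicity P (b m); rewrite leqNgt.
have e0 : (0 < e)%N by rewrite multiplicity_gt0 ?unit_orbit_neq0.
have Pe : P ^+ e.+1 %| b m ^+ 2.
  apply: dvdp_trans (_ : (P ^+ e) ^+ 2 %| _).
    by rewrite -exprM; apply: dvdp_exp2l; lia.
  by rewrite dvdp_exp2r // multiplicityP ?unit_orbit_neq0.
have := unit_orbit_modn m (n - m).-1.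
rewrite prednK ?subn_gt0 // subnKC ?(ltnW mn) // => /(dvdp_trans Pe) Pbb.
rewrite -multiplicityP ?unit_orbit_neq0 //.
rewrite -(subrK (b (n - m)) (b n)) dvdp_addr //.
rewrite multiplicityP ?unit_orbit_neq0 ?subn_gt0 // -leqNgt.
apply: IHn; rewrite ?subn_gt0 //; lia.
Qed.

Lemma multiplicity_unit_orbit_le_prod P n i : irreducible_poly P ->
    P %| b n.+2 -> (0 < i < n.+2)%N -> P %| b i ->
  (multiplicity P (b n.+2) <= multiplicity P (\prod_(1 <= m < n.+1) b m))%N.
Proof.
move=> irrP Pn /andP[i0 ilt] Pi.
have ex : exists m, (0 < m)%N && (P %| b m) by exists i; rewrite i0.
case: (ex_minnP ex) => m /andP[m0 Pm] minm.
have mle : (m <= i)%N by rewrite minm ?i0.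
(* Consecutive terms are coprime, so the first b_m divisible by P already occurs in the product up
   to b_n. *)
have mn1 : m != n.+1.
  by apply: contraTneq Pm => ->; case: (coprime_unit_orbit irrP Pn).
apply: leq_trans (multiplicity_unit_orbit_le irrP m0 _ Pm _) _ => //.
  move=> k /andP[k0 km]; apply: contraTN km => Pk.
  by rewrite -leqNgt minm ?k0.
rewrite -multiplicityP ?prod_unit_orbit_neq0 //.
apply: dvdp_trans (_ : b m %| _); first by rewrite multiplicityP ?unit_orbit_neq0.
rewrite (big_cat_nat (n := m)) /=; [|lia|lia].
rewrite [X in _ * X]big_ltn; last by lia.
exact/dvdp_mull/dvdp_mulr.
Qed.

(** * The derivative of b_(n+1) and its cofactor [w n] *)

Definition reduced_deriv n := h^`() * b n + (h * (b n)^`()) *+ d.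

Local Notation w := reduced_deriv.

Lemma deriv_unit_orbit n : (b n.+1)^`() = b n ^+ d.-1 * w n.
Proof.
rewrite unit_orbitS derivD derivC addr0 derivM deriv_exp /w mulrDr.
have dE : d = d.-1.+1 by lia.
rewrite [in X in X + _]dE exprS; congr (_ + _); first by rewrite mulrA mulrC.
by rewrite !mulrnAr; congr (_ *+ _); rewrite [RHS]mulrCA [X in h * X]mulrC.
Qed.

(** Otherwise h would divide h' b_(n+1), hence h', since b_(n+1) is 1 modulo h; but h' has smaller
    degree. *)
Lemma reduced_deriv_neq0 n : w n.+1 != 0.
Proof.
apply: contraTneq (deg_deriv_lt h'0) => w0; rewrite -leqNgt.
apply: deg_dvdp => //.
have : h %| h^`() * b n.+1.
  rewrite -(addrK ((h * (b n.+1)^`()) *+ d) (_ * _)) -/(w n.+1) w0 sub0r dvdpNr.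
  by rewrite -mulrnAr dvdp_mulr.
by rewrite unit_orbitS mulrDr mulr1 dvdp_addr // dvdp_mull // dvdp_mulr.
Qed.

Lemma deg_reduced_deriv n : (0 < n)%N -> (deg (w n) < deg h + D n)%N.
Proof.
move=> n0; have b0 := unit_orbit_neq0 n0; have h0 := base_neq0.
have dh := deg_deriv_lt h'0; apply: leq_ltn_trans (degD _ _) _.
rewrite gtn_max degM // ltn_add2r dh -mulrnAr.
(* This factor can vanish, as for b_1 = 1; strictness then comes from deg h > 0 rather than from the
   drop under derivation. *)
have [->|b'0] := eqVneq ((b n)^`() *+ d) 0.
  by rewrite mulr0 /deg size_poly0 addn_gt0 deg_base_gt0.
rewrite degM // ltn_add2l; rewrite -derivMn in b'0 *.
apply: leq_trans (deg_deriv_lt b'0) _.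
by rewrite /deg -scaler_nat -!subn1 leq_sub2r // size_scale_leq.
Qed.

End Orbit.

(** * Existence of primitive simple divisors *)

Lemma exp_dvdp_deriv (F : fieldType) (P f : {poly F}) e :
  P ^+ e.+1 %| f -> P ^+ e %| f^`().
Proof.
case/dvdpP => u ->; rewrite derivM deriv_exp /= exprS -mulrnAr.
by apply: dvdp_add; rewrite ?mulrA dvdp_mull // -mulr_natr dvdp_mulr.
Qed.

(** Any P with e = v_P(b_(n+3)) > 2 v_P(w) + v_P(S) works: a nonprimitive P would have e <= v_P(S),
    and a primitive one has e - 1 <= v_P(w), so e > 2(e - 1) forces e = 1. *)
Lemma unit_orbit_primitive_simple (F : finFieldType) (h : {poly F}) d n :
    h^`() != 0 -> (3 <= d)%N ->
  exists P, [/\ irreducible_poly P, multiplicity P (unit_orbit h d n.+3) = 1%N,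
    ~~ (P %| h) & forall i, (0 < i < n.+3)%N -> ~~ (P %| unit_orbit h d i)].
Proof.
move=> h'0 hd; set w := reduced_deriv h d n.+2.
set S := \prod_(1 <= m < n.+2) unit_orbit h d m.
have w0 : w != 0 := reduced_deriv_neq0 _ h'0 _.
have S0 : S != 0 := prod_unit_orbit_neq0 h'0 hd _.
have b0 : unit_orbit h d n.+3 != 0 by exact: unit_orbit_neq0.
have wS0 : w ^+ 2 * S != 0 by rewrite mulf_neq0 ?expf_neq0.
(* With H = deg h and D = deg b_(n+2), deg w <= H + D - 1 and deg S <= D - H, so w^2 S has degree at
   most H + 3D - 2, less than H + dD = deg b_(n+3). *)
have Nb : ~~ (unit_orbit h d n.+3 %| w ^+ 2 * S).
  have := deg_reduced_deriv h'0 hd (ltn0Sn n.+1).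
  have := deg_unit_orbit_sum h'0 hd (ltn0Sn n).
  have := deg_unit_orbitS h'0 hd (ltn0Sn n.+1).
  rewrite -/w => Db Sb Dw; apply/negP => /(deg_dvdp wS0).
  rewrite degM ?expf_neq0 // degX deg_prod_unit_orbit //; nia.
have [P irrP] := Ndvdp_multiplicity b0 wS0 Nb.
rewrite expr2 !multiplicityM ?mulf_neq0 // => ltP.
have Pb : P %| unit_orbit h d n.+3 by rewrite -multiplicity_gt0 //; lia.
have [NPh NPb] := coprime_unit_orbit hd irrP Pb.
exists P; split => //; last first.
  move=> i ilt; apply/negP => Pi.
  have := multiplicity_unit_orbit_le_prod h'0 hd irrP Pb ilt Pi.
  by move: ltP; rewrite -/S; lia.
have : P ^+ (multiplicity P (unit_orbit h d n.+3)).-1 %| w.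
  have : P ^+ (multiplicity P (unit_orbit h d n.+3)).-1 %| (unit_orbit h d n.+3)^`().
    by apply: exp_dvdp_deriv; rewrite multiplicityP // prednK //; lia.
  (* P is prime to b_(n+2), so its power passes to the cofactor w. *)
  rewrite deriv_unit_orbit // Gauss_dvdpr // coprimep_expl // coprimep_expr //.
  by rewrite irreducible_poly_coprime.
by rewrite multiplicityP //; lia.
Qed.

(** Substitute x = t y: c (t y)^d + t = t (h y^d + 1) with h = c t^(d-1). *)
Lemma orbit0E (F : fieldType) (c : {poly F}) d n : (0 < d)%N ->
  orbit0 c d n = 'X * unit_orbit (c * 'X ^+ d.-1) d n.
Proof.
move=> d0; elim: n => [|n IHn]; first by rewrite mulr0.
rewrite unit_orbitS {1}/orbit0 iterS -/(orbit0 c d n) IHn /fc.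
rewrite hornerD hornerZ hornerXn hornerC mulrDr mulr1; congr (_ + _).
have Xd : 'X ^+ d = 'X * 'X ^+ d.-1 :> {poly F} by rewrite -exprS prednK.
by rewrite exprMn Xd -!mulrA [LHS]mulrCA.
Qed.

Theorem theoremA1 (p e q : nat) (hp : prime p) (he : (0 < e)%N)
    (hq : q = (p ^ e)%N) (hodd : odd q)
    (F : finFieldType) (hF : #|F| = q)
    (d : nat) (hd : (3 <= d)%N) (hpd : ~~ (p %| d)%N)
    (c : {poly F}) (hc : c != 0)
    (hh : ~ exists g : {poly F}, c * 'X ^+ d.-1 = g \Po 'X^p) :
  exists2 N0 : nat, (4 <= N0)%N &
    forall n : nat, (N0 <= n)%N ->
      exists P : {poly F},
        [/\ irreducible_poly P,
            adic_val P (orbit0 c d n)%:F = 1%:E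
          & ~~ (P %| c * 'X * \prod_(1 <= i < n) orbit0 c d i)].
Proof.
have pF : p \in [pchar F] by apply: (@card_finPcharP F p e) => //; rewrite hF.
have h'0 : (c * 'X ^+ d.-1)^`() != 0.
  by apply/eqP => h'0; apply: hh; apply: deriv0_comp_polyXp.
have d0 : (0 < d)%N by lia.
exists 4%N => // -[|[|[|n]]] // _.
have [P [irrP P1 NPh Pi]] := unit_orbit_primitive_simple n h'0 hd.
have [NPc NPX] : ~~ (P %| c) /\ ~~ (P %| 'X).
  split; apply: contraNN NPh => Px; first exact: dvdp_mulr.
  by apply/dvdp_mull/(dvdp_trans Px)/dvdp_exp; first lia.
have NPM (x y : {poly F}) : ~~ (P %| x) -> ~~ (P %| y) -> ~~ (P %| x * y).
  by rewrite -!irreducible_poly_coprime // coprimepMr => -> ->.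
exists P; split => //.
  have b0 := unit_orbit_neq0 h'0 hd (ltn0Sn n.+2).
  (* View a_n as a_n / 1; P divides neither t nor 1, so v_P(a_n) = v_P(b_n) = 1. *)
  rewrite -[X in adic_val _ X]divr1 -tofrac1 adic_val_div ?oner_neq0 //; last first.
    by rewrite orbit0E // mulf_neq0 ?polyX_eq0.
  have mult0 (x : {poly F}) : x != 0 -> ~~ (P %| x) -> multiplicity P x = 0%N.
    by move=> x0; rewrite -multiplicity_gt0 // -eqn0Ngt => /eqP.
  rewrite orbit0E // multiplicityM ?polyX_eq0 // P1 !mult0 ?polyX_eq0 ?oner_neq0 //.
  by rewrite dvdp1; case: irrP => + _; case: (size P) => [|[]].
apply: (NPM); first exact: NPM.
rewrite big_nat; elim/big_ind: _ => [|x y|i ilt]; last 2 first.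
- exact: NPM.
- by rewrite orbit0E // NPM // Pi.
by rewrite dvdp1; case: irrP => + _; case: (size P) => [|[]].
Qed.
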